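(* Let $X$ be a finite set and let $f$ be a Plott function on $X$. Let $\mathcal P(f)$ be the set of all pieces of the convex geometry $\mathcal F$ corresponding to $f$, partially ordered by inclusion $\subset$, and let $\phi:\mathcal P(f)\to X$ be the map sending a piece $P$ to the unique element of $X$ of which $P$ is a piece. Then the triple $(\mathcal P(f),\subset,\phi)$ is an SS-rationalization of $f$.
   Context: A choice function on $X$ is a map $f:2^X\to 2^X$ with $f(A)\subset A$ for all $A\subset X$ (empty values are allowed). $f$ is a Plott function if $f(A\cup B)=f(f(A)\cup B)$ for all $A,B\subset X$. The convex geometry $\mathcal F$ corresponding to a Plott function $f$ is the family of closed (also called convex) sets of the closure operator on $X$ under which the closure of $A\subset X$ is $\{x\in X: f(A)=f(A\cup\{x\})\}$. A set $P\in\mathcal F$ is a piece of an element $x\in X$ if $x\notin P$ and $x\in Q$ for every $Q\in\mathcal F$ with $P\subset Q$, $P\neq Q$. A set $P\in\mathcal F$ is a piece if it is a piece of some element; each piece is a piece of exactly one element of $X$. For a partial order $\le$ on a finite set $Y$, the Plott function on $Y$ rationalizable by $\le$ is $g(B)=\{$maximal elements of $B$ with respect to $\le\}$, $B\subset Y$. For a map $\psi:Y\to X$ and a choice function $g$ on $Y$, the direct image is the choice function $\psi_*(g)(A)=\psi(g(\psi^{-1}(A)))$, $A\subset X$. A triple $(Y,\le,\psi)$, with $\le$ a partial order on $Y$ and $\psi:Y\to X$ a map, is an SS-rationalization of $f$ if $f=\psi_*(g)$, where $g$ is the Plott function on $Y$ rationalizable by $\le$. *)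

(* Defs.v *)
From mathcomp Require Import all_boot.

Set Implicit Arguments.
Unset Strict Implicit.
Unset Printing Implicit Defensive.

Section ChoiceFunctions.

Variable X : finType.
Implicit Types (f : {set X} -> {set X}) (A B P Q : {set X}) (x y : X).

Definition choice_function f : Prop := forall A, f A \subset A.

Definition plott_function f : Prop :=
  choice_function f /\ (forall A B, f (A :|: B) = f (f A :|: B)).

Definition closure_op f A : {set X} := [set x | f A == f (x |: A)].

Definition convex_geometry f : {set {set X}} :=
  [set P | closure_op f P == P].

Definition piece_of f x P : bool :=
  [&& P \in convex_geometry f, x \notin P &
      [forall Q in convex_geometry f, (P \proper Q) ==> (x \in Q)]].

Definition is_piece f P : bool := [exists x, piece_of f x P].

Definition piece f : finType := {P : {set X} | is_piece f P}.

Definition piece_incl f : rel (piece f) :=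
  fun P Q : piece f => val P \subset val Q.

(* The element is selected by choice among those of which P is a piece; when f *)
(* is a Plott function there is only one (piece_of_inj, piece_elt_uniq).       *)
Definition piece_elt f (P : piece f) : X := xchoose (existsP (valP P)).

End ChoiceFunctions.

Definition maximal_elements (Y : finType) (le : rel Y) (B : {set Y}) : {set Y} :=
  [set y in B | [forall z in B, le y z ==> (z == y)]].

Definition direct_image (Y X : finType) (psi : Y -> X)
    (g : {set Y} -> {set Y}) (A : {set X}) : {set X} :=
  psi @: g (psi @^-1: A).

Definition partial_order (Y : Type) (le : rel Y) : Prop :=
  [/\ reflexive le, antisymmetric le & transitive le].

Definition SS_rationalization (X : finType) (f : {set X} -> {set X})
    (Y : finType) (le : rel Y) (psi : Y -> X) : Prop :=
  partial_order le /\ f =1 direct_image psi (maximal_elements le).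

Section PieceUniqueness.

Variables (X : finType) (f : {set X} -> {set X}).
Hypothesis fP : plott_function f.
Implicit Types (A P : {set X}) (x y : X).

Lemma sub_closure_op A : A \subset closure_op f A.
Proof. by apply/subsetP=> x xA; rewrite inE (setUidPr _) ?sub1set. Qed.

Lemma choice_closure_op A : f (closure_op f A) = f A.
Proof.
have [_ pi] := fP.
suff fU s : {subset s <= closure_op f A} -> f (A :|: [set:: s]) = f A.
  have sub : {subset enum (closure_op f A) <= closure_op f A}.
    by move=> x; rewrite mem_enum.
  rewrite -[RHS](fU _ sub).
  congr (f _); apply/setP=> x; rewrite in_setU [x \in [set:: _]]inE mem_enum.
  by case: (boolP (x \in A)) => // /(subsetP (sub_closure_op A)) ->.
elim: s => [_|x s IHs sub]; first by congr (f _); apply/setP=> y; rewrite !inE orbF.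
have xc : x \in closure_op f A by apply: sub; rewrite mem_head.
have -> : A :|: [set:: x :: s] = (A :|: [set:: s]) :|: [set x].
  by apply/setP=> y; rewrite !inE [(y == x) || _]orbC orbA.
rewrite pi IHs => [|y ys]; last by apply: sub; rewrite in_cons ys orbT.
by rewrite -pi setUC; move: xc; rewrite inE => /eqP.
Qed.

Lemma closure_op_closed A : closure_op f A \in convex_geometry f.
Proof.
have [_ pi] := fP; rewrite inE; apply/eqP/setP=> x.
rewrite inE choice_closure_op [x |: _]setUC pi choice_closure_op -pi setUC.
by rewrite [RHS]inE.
Qed.

Lemma piece_of_inj x y P : piece_of f x P -> piece_of f y P -> x = y.
Proof.
have [fsub pi] := fP.
move=> /and3P[Pc xP /forall_inP xQ] /and3P[_ yP /forall_inP yQ].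
apply/eqP/negPn/negP => nxy.
have prop z : z \notin P -> P \proper closure_op f (z |: P).
  move=> zP; apply: proper_sub_trans (sub_closure_op _).
  by rewrite properE subsetUr subUset sub1set (negPf zP).
have eqy : f (x |: P) = f (y |: (x |: P)).
  have := implyP (yQ _ (closure_op_closed _)) (prop x xP).
  by rewrite inE => /eqP.
have eqx : f (y |: P) = f (x |: (y |: P)).
  have := implyP (xQ _ (closure_op_closed _)) (prop y yP).
  by rewrite inE => /eqP.
have sP : f (x |: P) \subset P.
  apply/subsetP=> z zf.
  have zx := subsetP (fsub _) _ zf.
  have zy : z \in y |: P.
    by apply: (subsetP (fsub _)); rewrite eqx setUCA -eqy.
  move: zx zy; rewrite !in_setU1 => /orP[/eqP->|//].
  by rewrite (negPf nxy).
have eP : f P = f (x |: P).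
  by rewrite -[in RHS](setUid P) setUA pi (setUidPr sP).
move: Pc xP; rewrite inE => /eqP Pc; rewrite -Pc inE.
by rewrite eP eqxx.
Qed.

Lemma piece_eltP (P : piece f) : piece_of f (piece_elt P) (val P).
Proof. exact: (xchooseP (existsP (valP P))). Qed.

Lemma piece_elt_uniq (P : piece f) x : piece_of f x (val P) -> piece_elt P = x.
Proof. exact: piece_of_inj (piece_eltP P). Qed.

End PieceUniqueness.

(* Main.v *)
Require Import Defs.
From mathcomp Require Import all_boot.

(** Since [X] is finite, every closed set that misses an element [x] extends to
    a maximal one missing [x], and such a maximal set is a piece of [x]
    ([piece_extension]).  This supplies the pieces needed for both inclusions
    between [f A] and the set of the elements [piece_elt P], for [P] maximal
    among the pieces with [piece_elt P] in [A].

    If [x] is in [f A] ([choice_piece]), then [x] is not in the closure of [A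
    :\ x], so some piece [P] of [x] contains [A :\ x]. A strictly larger closed
    set contains [x] as well, hence all of [A], and cannot be a piece of an
    element of [A].

    If [x] is in [A] but not in [f A] ([maximal_piece_choice]), no piece [P] of
    [x] is maximal. The closure of [f A] contains [A], hence [x], so some [y]
    in [f A] lies outside [P]. The closure of [x |: P] is the least closed set
    strictly above [P]; it does not contain [y], for otherwise [P] would be a
    piece of both [x] and [y] ([closure_piece_succ]). A piece of [y] above that
    closure is strictly larger than [P]. *)

Set Implicit Arguments.
Unset Strict Implicit.
Unset Printing Implicit Defensive.

Section Pieces.

Variables (X : finType) (f : {set X} -> {set X}).
Hypothesis fP : plott_function f.
Implicit Types (A P Q : {set X}) (x y : X).

(** By path independence, the equality [f A = f (x |: A)] survives taking the
    union of both arguments with [Q]. *)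
Lemma closure_op_min A Q :
  Q \in convex_geometry f -> A \subset Q -> closure_op f A \subset Q.
Proof.
have [_ pi] := fP; rewrite inE => /eqP Qc AQ.
apply/subsetP=> x; rewrite inE => /eqP eA; rewrite -Qc inE.
by rewrite -{2}(setUidPr AQ) setUA pi -eA -pi (setUidPr AQ).
Qed.

(** Path independence with an empty union gives [f (f A) = f A], and with
    [[set x]] it gives [f (x |: f A) = f (x |: A)], which is [f A] for [x] in
    [A]. *)
Lemma sub_closure_choice A : A \subset closure_op f (f A).
Proof.
have [_ pi] := fP; apply/subsetP=> x xA; rewrite inE.
rewrite -[f A in X in X == _]setU0 -pi setU0 setUC -pi setUC.
by rewrite (setUidPr _) ?sub1set.
Qed.

Lemma choice_notin_closure A x : x \in f A -> x \notin closure_op f (A :\ x).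
Proof.
have [fsub _] := fP => xf; have xA := subsetP (fsub A) x xf.
rewrite inE setD1K //; apply: contraTN xf => /eqP <-.
by apply/negP=> /(subsetP (fsub _)); rewrite setD11.
Qed.

(** The witness is a maximal closed set above [Q] missing [x]: maximality is
    what forces every larger closed set to contain [x]. *)
Lemma piece_extension x Q : Q \in convex_geometry f -> x \notin Q ->
  exists2 P : piece f, Q \subset val P & piece_elt P = x.
Proof.
move=> Qc xQ; pose p P := (P \in convex_geometry f) && (x \notin P).
have [|P /maxsetP[/andP[Pc xP] maxP] QP] := @maxset_exists _ p Q.
  by rewrite /p Qc.
have Px : piece_of f x P.
  apply/and3P; split=> //; apply/forall_inP=> R Rc; apply/implyP=> PR.
  apply: contraT => xR; have pR : p R by rewrite /p Rc.
  by move: (PR); rewrite (maxP R pR (proper_sub PR)) properxx.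
have pP : is_piece f P by apply/existsP; exists x.
by exists (Sub P pP : piece f) => //; apply: (piece_elt_uniq fP).
Qed.

Lemma choice_piece A x : x \in f A -> exists2 P : piece f,
  P \in maximal_elements (@piece_incl X f) (@piece_elt X f @^-1: A)
  & piece_elt P = x.
Proof.
move=> xf; have xA := subsetP (fP.1 A) x xf.
have [P sP Px] :=
  piece_extension (closure_op_closed fP (A :\ x)) (choice_notin_closure xf).
have {}sP := subset_trans (sub_closure_op f (A :\ x)) sP.
exists P => //; rewrite !inE Px xA; apply/forall_inP=> R.
rewrite inE => RA; apply/implyP=> PR; apply: contraLR RA => nRP.
have /and3P[Rc eR _] := piece_eltP R.
have /and3P[_ _ /forall_inP/(_ _ Rc)/implyP xR] := piece_eltP P.
(* A strictly larger piece [R] contains [A :\ x] and [x], hence the whole of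
   [A], whereas it does not contain its own element. *)
have {}xR : x \in val R.
  by rewrite -Px xR // properEneq [_ \subset _]PR andbT eq_sym (inj_eq val_inj).
apply: contra eR => eA; have [-> // | nx] := eqVneq (piece_elt R) x.
by apply: (subsetP PR); apply: (subsetP sP); rewrite in_setD1 nx.
Qed.

(** Every closed set strictly above [val P] contains [piece_elt P], hence
    contains this closure.  An element [y] added by the closure therefore has
    [val P] as a piece, and a piece belongs to one element only. *)
Lemma closure_piece_succ (P : piece f) y : y \notin val P ->
  y \in closure_op f (piece_elt P |: val P) -> y = piece_elt P.
Proof.
move=> yP yc; have /and3P[Pc _ /forall_inP xQ] := piece_eltP P.
apply/esym/(piece_elt_uniq fP)/and3P; split=> //.
apply/forall_inP=> Q Qc; apply/implyP=> PQ.
apply: (subsetP (closure_op_min Qc _)) yc.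
by rewrite subUset sub1set (implyP (xQ Q Qc) PQ) proper_sub.
Qed.

Lemma maximal_piece_choice A (P : piece f) :
  P \in maximal_elements (@piece_incl X f) (@piece_elt X f @^-1: A) ->
  piece_elt P \in f A.
Proof.
rewrite !inE => /andP[xA /forall_inP maxP].
have /and3P[Pc xP _] := piece_eltP P.
apply: contraNT xP => xf.
have [fAP | /subsetPn[y yf yP]] := boolP (f A \subset val P).
  apply: (subsetP (closure_op_min Pc fAP)).
  exact: (subsetP (sub_closure_choice A)).
have yc : y \notin closure_op f (piece_elt P |: val P).
  by apply: contra xf => /(closure_piece_succ yP) <-.
(* A piece of [y] above this closure also lies strictly above [val P]. *)
have [R sR Ry] := piece_extension (closure_op_closed fP _) yc.
have {}sR := subset_trans (sub_closure_op f _) sR.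
have RA : R \in @piece_elt X f @^-1: A by rewrite inE Ry (subsetP (fP.1 A)).
have PR : piece_incl P R := subset_trans (subsetUr _ _) sR.
have /eqP eRP := implyP (maxP R RA) PR.
by rewrite -[X in val X]eRP; apply: (subsetP sR); rewrite setU11.
Qed.

End Pieces.

Theorem theorem3 (X : finType) (f : {set X} -> {set X}) (hf : plott_function f) :
  SS_rationalization f (@piece_incl X f) (@piece_elt X f).
Proof.
split.
  split; first by move=> P; apply: subxx.
    by move=> P Q PQ; apply/val_inj/eqP; rewrite eqEsubset.
  by move=> P Q R; apply: subset_trans.
move=> A; apply/setP=> x; apply/idP/imsetP => [xf | [P Pmax ->]].
  by have [P Pmax <-] := choice_piece hf xf; exists P.
exact: maximal_piece_choice hf _ _ Pmax.
Qed.
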